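(* For every Cantor set $K \subset \mathbb{R}$ and every $n\in \mathbb{N}$, there exists a Cantor set $\widetilde{K} \subset \mathbb{R}$ with $|\widetilde{K}|>|K|$ such that $\left( \Delta^n_{y} (K \times \widetilde{K} ) \right)^\circ \neq \varnothing$ for some $y\in K\times \widetilde{K}$, where the interior is taken in $\mathbb{R}^n$.
   Context: A Cantor set is a subset of $\mathbb{R}^d$ that is compact, totally disconnected, and perfect. For a subset of $\mathbb{R}$, $|\cdot|$ denotes Lebesgue measure; for a vector, $|\cdot|$ denotes the Euclidean norm; $(\cdot)^\circ$ denotes the interior. For $X\subset\mathbb{R}^2$, $n\in\mathbb{N}$ ($n\ge 1$) and a pin $x\in X$, the pinned $n$-chain distance set is $$\Delta_x^n(X)=\{(|x^0-x^1|,|x^1-x^2|,\dots,|x^{n-1}-x^n|) : x^0=x,\ x^i\in X,\ x^i\neq x^j \text{ for } i\neq j\}\subset\mathbb{R}^n,$$ where $i,j$ range over $\{0,1,\dots,n\}$. *)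

(* Defs.v *)
From HB Require Import structures.
From mathcomp Require Import all_boot all_order all_algebra.
From mathcomp Require Import all_classical all_reals all_analysis.

Set Implicit Arguments.
Unset Strict Implicit.
Unset Printing Implicit Defensive.

Import Order.TTheory GRing.Theory Num.Theory.
Import numFieldNormedType.Exports.

Local Open Scope classical_set_scope.
Local Open Scope ring_scope.

(* Nonemptiness is explicit: set0 satisfies the three other conditions. *)
Definition Cantor_set (T : topologicalType) (A : set T) : Prop :=
  [/\ A !=set0, compact A, totally_disconnected A & perfect_set A].

(* The library norm on R * R is the max norm, hence this definition. *)
Definition euclidean_norm (R : realType) (v : R * R) : R :=
  Num.sqrt (v.1 ^+ 2 + v.2 ^+ 2).

Definition chain_distances (R : realType) (n : nat)
    (x : 'I_n.+1 -> R * R) : 'rV[R]_n :=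
  \row_(i < n) euclidean_norm (x (widen_ord (leqnSn n) i) - x (lift ord0 i)).

Definition pinned_chain_distance_set (R : realType) (n : nat)
    (X : set (R * R)) (p : R * R) : set 'rV[R]_n :=
  [set t | exists x : 'I_n.+1 -> R * R,
    [/\ x ord0 = p, (forall i, X (x i)), injective x
      & t = chain_distances x]].

(* Main.v *)
Require Import Defs.
From HB Require Import structures.
From mathcomp Require Import all_boot all_order all_algebra.
From mathcomp Require Import all_classical all_reals all_analysis.
From mathcomp Require Import lra.

Set Implicit Arguments.
Unset Strict Implicit.
Unset Printing Implicit Defensive.

Import Order.TTheory GRing.Theory Num.Theory.
Import numFieldNormedType.Exports.

Local Open Scope classical_set_scope.
Local Open Scope ring_scope.

(** The given set [K] may be extremely thin, so that nothing can be gained from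
    its size; but it has no isolated point, and [K'] may be chosen after it.

    All chains are made to climb.  Let the lengths range over an interval
    [[a, b]] with [a] larger than the diameter of [K].  From a point [(k, c)],
    the points at distance [d] above it, over the abscissas of [K], have heights
    [c + sqrt (d^2 - (x - k)^2)] for [x] in [K].  It suffices to find a Cantor set
    [K'] that meets this set of heights for every [c] in a fixed bounded range,
    every [k] in [K] and every [d] in [[a, b]].  Indeed any sequence of [n]
    lengths in [[a, b]] is then realised step by step from one pin
    ([ascending_chain]), the vertices are distinct since their heights increase,
    and the distance set contains a cube.

    The parameters [(c, k, d)] form a compact set, and the heights are functions
    of [x] that are constant near no point of [K].  So if an open set meets the
    heights for every parameter, it still does after the removal of any
    sufficiently small closed interval about a given point: a perturbation of
    [x] avoids the point, and compactness makes the radius uniform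
    ([meets_curves_setD_itv]).  Removing in this way successive small intervals
    about the rationals from an interval [[0, M]] leaves a Cantor set of measure
    at least [M - 1] ([sparse_Cantor_set]), and compactness of [K] shows that the
    limit still meets the heights for every parameter
    ([Cantor_set_meeting_curves]).  With [M] large this set is also larger than
    [K]. *)

(** * Cantor sets given by their gaps *)

(** Gaps with dense union leave no interval, so the set is totally disconnected.
    It is perfect because there are gaps arbitrarily near to any of its points
    [x], on either side within [[0, M]], whose endpoints belong to the set since
    the closed gaps are disjoint.  These endpoints differ from [x] unless [x] is
    an endpoint itself; but [x] cannot end a gap on its left and another on its
    right, and 0 and [M] end no gap. *)
Lemma Cantor_set_gap_complement (R : realType) (M : R) (l r : nat -> R) :
  0 < M ->
  (forall j, l j < r j -> 0 < l j /\ r j < M) ->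
  (forall i j, i != j -> l i < r i -> l j < r j -> r i < l j \/ r j < l i) ->
  (forall a b, 0 <= a -> a < b -> b <= M ->
     exists2 m, a < m < b & (\bigcup_j `]l j, r j[%classic) m) ->
  Cantor_set (`[0, M]%classic `\` \bigcup_j `]l j, r j[%classic).
Proof.
move=> M0 gapM gap_disj gap_dense; set C := _ `\` _.
have CE x : C x <-> 0 <= x <= M /\ forall j, ~~ (l j < x < r j).
  rewrite /C /= in_itv/=; split=> -[xM xg]; split => //.
    by move=> j; apply/negP => xj; apply: xg; exists j => //=; rewrite in_itv.
  by move=> [j _ /=]; rewrite in_itv/=; exact/negP.
have cptC : compact C.
  apply: (subclosed_compact _ (segment_compact (a := 0) (b := M))) => [|x []//].
  apply: closedI; first exact: itv_closed.
  apply: open_closedC; apply: bigcup_open => j _; exact: itv_open.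
have Cl j : l j < r j -> C (l j).
  move=> lr; have [l0 rM] := gapM _ lr; apply/CE; split; first lra.
  move=> i; apply/negP => li; have [ij|ij] := eqVneq i j.
    by move: li; rewrite ij; lra.
  have lri : l i < r i by lra.
  by have [] := gap_disj _ _ ij lri lr; lra.
have Cr j : l j < r j -> C (r j).
  move=> lr; have [l0 rM] := gapM _ lr; apply/CE; split; first lra.
  move=> i; apply/negP => li; have [ij|ij] := eqVneq i j.
    by move: li; rewrite ij; lra.
  have lri : l i < r i by lra.
  by have [] := gap_disj _ _ ij lri lr; lra.
split.
- exists 0; apply/CE; split; first lra.
  by move=> j; apply/negP => j0; have [] := gapM j ltac:(lra); lra.
- exact: cptC.
- move=> x Cx; apply/seteqP; split; last first.
    by move=> _ ->; apply: connected_component_refl.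
  have noitv u v (B : set R) : B `<=` C -> connected B -> B u -> B v -> ~ u < v.
    move=> BC /connected_intervalP iB Bu Bv uv.
    have [/CE[u0 _] /CE[v0 _]] := (BC _ Bu, BC _ Bv).
    have [m /andP[um mv] [j _]] := gap_dense u v ltac:(lra) uv ltac:(lra).
    have /CE[_ /(_ j)] : C m by apply/BC/(iB u v) => //; rewrite !ltW.
    by move=> /negP; rewrite /= in_itv.
  move=> y [B [Bx BC cB] By] /=.
  apply/eqP; rewrite eq_le !leNgt; apply/andP; split; apply/negP => h.
    exact: (noitv _ _ _ BC cB Bx By h).
  exact: (noitv _ _ _ BC cB By Bx h).
- split; first by apply: compact_closed => //; exact: Rhausdorff.
  apply/seteqP; split => x.
    move=> xC; rewrite (closure_id C).1; last first.
      by apply: compact_closed => //; exact: Rhausdorff.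
    by move=> U /xC[y [_ Cy Uy]]; exists y.
  move=> Cx U /nbhs_ballP[e /= e0 xeU].
  have /CE[/andP[x0 xM] xgap] := Cx.
  have right_side : x < M ->
      (exists y, [/\ y != x, C y & U y]) \/ exists2 j, l j < r j & l j = x.
    move=> xltM.
    have [m /andP[xm mb] [j _]] := gap_dense x (Num.min M (x + e)) x0
      ltac:(by rewrite lt_min; apply/andP; split; lra) ltac:(by rewrite ge_min lexx).
    rewrite /= in_itv/= => /andP[lm mr]; have lr := lt_trans lm mr.
    move: mb; rewrite lt_min => /andP[_ mxe].
    have xl : x <= l j by rewrite leNgt; apply: contra (xgap j) => ->/=; lra.
    have [lx|lx] := eqVneq (l j) x; first by right; exists j.
    left; exists (l j); split => //; first exact: Cl.
    by apply: xeU; rewrite /ball/= ltr_norml; lra.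
  have left_side : 0 < x ->
      (exists y, [/\ y != x, C y & U y]) \/ exists2 j, l j < r j & r j = x.
    move=> xgt0.
    have [m /andP[mb mx] [j _]] := gap_dense (Num.max 0 (x - e)) x
      ltac:(by rewrite le_max lexx) ltac:(by rewrite gt_max; apply/andP; split; lra) xM.
    rewrite /= in_itv/= => /andP[lm mr]; have lr := lt_trans lm mr.
    move: mb; rewrite gt_max => /andP[_ mxe].
    have xl : r j <= x by rewrite leNgt; apply: contra (xgap j) => ->; rewrite andbT; lra.
    have [lx|lx] := eqVneq (r j) x; first by right; exists j.
    left; exists (r j); split => //; first exact: Cr.
    by apply: xeU; rewrite /ball/= ltr_norml; lra.
  have [xltM|Mx] := ltP x M; last first.
    have [//|[j lr rx]] := left_side ltac:(lra).
    by have := gapM _ lr; lra.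
  have [//|[j lr lx]] := right_side xltM.
  have [//|[i lri rx]] := left_side ltac:(by have := gapM _ lr; lra).
  have [ij|ij] := eqVneq i j; first by move: lr lx rx; rewrite -ij; lra.
  by have [] := gap_disj _ _ ij lri lr; lra.
Qed.

(** The gaps are removed one at a time, centred at the rationals, which makes
    their union dense.  [Q] is a property that must survive at every finite
    stage: removing a small enough closed interval around a prescribed point
    preserves it, so a radius can be chosen for each rational in turn.  The
    stages [U n] are open and exclude the closures of the gaps chosen before,
    whence these closures are pairwise disjoint.  Property [Q] need not pass to
    the limit set; the last clause, by which each point that the limit set
    misses is left by the stages locally uniformly, is what a compactness
    argument needs in order to carry [Q] over. *)
Lemma sparse_Cantor_set (R : realType) (M e : R) (Q : set R -> Prop) :
  0 < M -> 0 < e -> Q `]0, M[%classic ->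
  (forall U g, open U -> Q U -> U g ->
     \forall r \near 0^'+, Q (U `\` `[g - r, g + r]%classic)) ->
  exists K : set R, exists U : nat -> set R,
    [/\ Cantor_set K, (M%:E <= lebesgue_measure K + e%:E)%E,
        forall n, Q (U n)
      & forall y, 0 < y < M -> ~ K y -> \forall y' \near y & n \near \oo, ~ U n y'].
Proof.
move=> M0 e0 QM Qstep.
pose q (m : nat) : R := ratr (odflt 0 (unpickle m)).
have step (mU : nat * set R) : exists r : R,
    r + r <= e / (2 ^ mU.1.+1)%:R /\ (open mU.2 -> Q mU.2 ->
      [/\ mU.2 (q mU.1) -> 0 < r /\ `[q mU.1 - r, q mU.1 + r] `<=` mU.2,
          ~ mU.2 (q mU.1) -> r = 0
        & Q (mU.2 `\` `[q mU.1 - r, q mU.1 + r]%classic)]).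
  case: mU => m V /=; have em : 0 < e / (2 ^ m.+1)%:R.
    by rewrite divr_gt0// ltr0n expn_gt0.
  have [[oV [QV Vq]]|bad] := pselect (open V /\ Q V /\ V (q m)); last first.
    exists 0; rewrite addr0 ltW//; split => // oV QV.
    have nVq : ~ V (q m) by move=> Vq; apply: bad.
    split=> //; suff -> : V `\` `[q m - 0, q m + 0]%classic = V by [].
    rewrite subr0 addr0 set_itv1; apply/setDidPl/disjoints_subset/subsetCr.
    by move=> _ ->.
  have /nbhs_ballP[d /= d0 dV] : nbhs (q m) V by exact: open_nbhs_nbhs.
  near (0 : R)^'+ => r.
  have r0 : 0 < r by near: r; exact: nbhs_right_gt.
  exists r; split; last (move=> _ _; split=> //).
  - have : r < e / (2 ^ m.+1)%:R / 2 by near: r; apply: nbhs_right_lt; lra.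
    by lra.
  - move=> _; split=> // y; rewrite /= in_itv/= => yq; apply: dV.
    have rd : r < d by near: r; apply: nbhs_right_lt.
    by rewrite /ball/= ltr_norml; lra.
  - by near: r; exact: Qstep.
(* A rational that already left the current stage gets radius 0: its open gap
   is then empty, and removing its closed gap, a point outside the stage,
   changes nothing, which spares the recursion a case distinction. *)
have [rad radP] := choice step.
pose U : nat -> set R := fix U n := if n is m.+1 then
  U m `\` `[q m - rad (m, U m), q m + rad (m, U m)]%classic else `]0, M[%classic.
pose r m := rad (m, U m); pose lo m := q m - r m; pose hi m := q m + r m.
have US m : U m.+1 = U m `\` `[lo m, hi m]%classic by [].
have UQ m : open (U m) /\ Q (U m).
  elim: m => [|m [oU QU]]; first by split => //; exact: itv_open.
  rewrite US; split; first by apply: openI => //; apply: closed_openC; exact: itv_closed.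
  by have [_ /(_ oU QU)[_ _]] := radP (m, U m).
have r_small m : r m + r m <= e / (2 ^ m.+1)%:R by have [] := radP (m, U m).
have r_gt0 m : U m (q m) -> 0 < r m /\ `[lo m, hi m] `<=` U m.
  by have [oU QU] := UQ m; have [_ /(_ oU QU)[+ _ _]] := radP (m, U m).
have r_eq0 m : ~ U m (q m) -> r m = 0.
  by have [oU QU] := UQ m; have [_ /(_ oU QU)[_ + _]] := radP (m, U m).
have Udec m n : (m <= n)%N -> U n `<=` U m.
  move=> /subnK <-; elim: (n - m)%N => // k IH x.
  by rewrite addSn US => -[/IH].
have gapE j : (lo j < hi j) = (0 < r j) by rewrite /lo /hi; apply/idP/idP; lra.
have gapU j : lo j < hi j -> `[lo j, hi j] `<=` U j.
  rewrite gapE => rj; have [/r_gt0[]//|/r_eq0 r0] := pselect (U j (q j)).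
  by rewrite r0 ltxx in rj.
have gap_disj i j : (i < j)%N -> lo i < hi i -> lo j < hi j ->
    hi i < lo j \/ hi j < lo i.
  move=> ij gi gj; have [ji|?] := leP (lo j) (hi i); last by left.
  have [ij'|?] := leP (lo i) (hi j); last by right.
  exfalso; have : U i.+1 (Num.max (lo i) (lo j)).
    apply: (Udec _ _ ij); apply: gapU => //=; rewrite in_itv/=.
    by rewrite le_max lexx orbT ge_max ij' /= ltW.
  by rewrite US => -[_]; apply; rewrite /= in_itv/= le_max lexx ge_max ji /= ltW.
(* A gap of radius 0 cannot be responsible for the removal of a point. *)
have outU m x : 0 < x < M -> ~ U m x ->
    exists i, [/\ (i < m)%N, lo i < hi i & lo i <= x <= hi i].
  move=> xM; elim: m => [|m IH]; first by rewrite /= in_itv.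
  rewrite US => nU; have [Ux|/IH[i [im gi xi]]] := pselect (U m x); last first.
    by exists i; split => //; exact: ltnW.
  have : lo m <= x <= hi m.
    by apply/negP => /negP xm; apply: nU; split => //=; rewrite in_itv; apply/negP.
  have [/r_gt0[r0 _]|/[dup] nUq /r_eq0 r0] := pselect (U m (q m)) => xm.
    by exists m; rewrite gapE r0.
  by case: nUq; have -> : q m = x by move: xm; rewrite /lo /hi r0; lra.
exists (`[0, M]%classic `\` \bigcup_j `]lo j, hi j[%classic), U; split.
- apply: Cantor_set_gap_complement => //.
  + move=> j gj; have in0 x : lo j <= x <= hi j -> 0 < x < M.
      by move=> xj; have := Udec 0 j (leq0n _) _ (gapU _ gj x _);
        rewrite /= !in_itv/=; apply.
    by have := in0 (lo j) ltac:(lra); have := in0 (hi j) ltac:(lra); lra.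
  + move=> i j; rewrite neq_ltn => /orP[ij|ij] gi gj; first exact: gap_disj.
    by apply/or_comm/gap_disj.
  + move=> a b a0 ab bM; have [p pab] := rat_in_itvoo ab.
    have qp : q (pickle p) = ratr p by rewrite /q pickleK.
    set m := pickle p in qp; move: pab; rewrite in_itv/= -qp => qab.
    have [j gj qj] : exists2 j, lo j < hi j & lo j <= q m <= hi j.
      have [/r_gt0[r0 _]|] := pselect (U m (q m)).
        by exists m; rewrite ?gapE// /lo /hi; lra.
      by move=> /outU[|j [_ gj qj]]; [lra|exists j].
    (* [q m] may be an endpoint of an earlier gap, hence survive; that gap
       nevertheless meets any interval around [q m]. *)
    have : Num.max a (lo j) < Num.min b (hi j).
      by rewrite gt_max !lt_min gj; apply/andP; split; lra.
    move=> /midf_lt; set c := (_ / _) => -[]; rewrite gt_max lt_min.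
    move=> /andP[ac jc] /andP[cb cj]; exists c; first by rewrite ac.
    by exists j => //=; rewrite in_itv/= jc.
- set G := \bigcup_j _.
  have mI (j : nat) : measurable (`]lo j, hi j[%classic : set (measurableTypeR R)).
    exact: measurable_itv.
  have mG : measurable (G : set (measurableTypeR R)) by exact: bigcupT_measurable.
  have mK : measurable (`[0, M]%classic `\` G : set (measurableTypeR R)).
    by apply: measurableD => //; exact: measurable_itv.
  have : (M%:E <= lebesgue_measure ((`[0%R, M]%classic `\` G) `|` G))%E.
    have -> : M%:E = lebesgue_measure (`[0%R, M]%classic : set R).
      by rewrite lebesgue_measure_itv/= lte_fin M0 oppr0 adde0.
    apply: le_measure; rewrite ?inE; [exact: measurable_itv|exact: measurableU|].
    by move=> x xM; have [xG|xG] := pselect (G x); [right|left].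
  move=> /le_trans; apply; apply: (le_trans (measureU2 _ mK mG)).
  apply: leeD2l; apply: (le_trans (measure_sigma_subadditive _ mI mG _)) => //.
  apply: le_trans (epsilon_trick0 xpredT (ltW e0)).
  apply: lee_nneseries => // j _; rewrite [leLHS]lebesgue_measure_itv/= lte_fin.
  case: ifPn => _; last by rewrite lee_fin divr_ge0// ltW.
  by rewrite -EFinB lee_fin; have := r_small j; rewrite /lo /hi; lra.
- by move=> n; have [] := UQ n.
- move=> y yM nK.
  have [j _ yj] : (\bigcup_j `]lo j, hi j[%classic) y.
    by apply: contrapT => ny; apply: nK; split => //=; rewrite in_itv/=; lra.
  exists (`]lo j, hi j[%classic, [set n | (j < n)%N]) => /=.
    split; last by exists j.+1.
    by apply: open_nbhs_nbhs; split => //; exact: itv_open.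
  move=> [x n] /= [xj jn] /(Udec _ _ jn); rewrite US => -[_]; apply.
  by move: xj; rewrite /= !in_itv/=; lra.
Unshelve. all: by end_near. Qed.

(** * Cantor sets meeting a compact family of curves *)

Definition meets_curves (R : realType) (T : Type) (P : set T) (K : set R)
    (F : T -> R -> R) (U : set R) : Prop :=
  forall p, P p -> exists2 x, K x & U (F p x).

(** For a fixed parameter the curve over [K] enters [U] at a point other than
    [g], because it is constant near no point of [K].  The same point of [K]
    serves all nearby parameters and all small radii, and compactness of the set
    of parameters makes the radius uniform. *)
Lemma meets_curves_setD_itv (R : realType) (T : topologicalType) (P : set T)
    (K : set R) (F : T -> R -> R) (U : set R) (g : R) :
  compact P -> (forall x, continuous (F^~ x)) -> (forall p, continuous (F p)) ->
  (forall p x g (V : set R), P p -> K x -> nbhs x V ->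
     exists x', [/\ K x', V x' & F p x' != g]) ->
  open U -> meets_curves P K F U ->
  \forall r \near 0^'+, meets_curves P K F (U `\` `[g - r, g + r]%classic).
Proof.
move=> compactP continuous_param continuous_curve nonconstant oU hU.
have /compact_near_coveringP := compactP.
move=> /(_ _ (0 : R)^'+ (fun r p => exists2 x, K x &
  (U `\` `[g - r, g + r]%classic) (F p x)) _); apply => p Pp.
have [x Kx Ux] := hU _ Pp.
have [|x' [Kx' Ux' ne_g]] := nonconstant _ _ g (F p @^-1` U) Pp Kx.
  by apply: continuous_curve; exact: open_nbhs_nbhs.
have d0 : 0 < `|F p x' - g| / 2 by rewrite divr_gt0// normr_gt0 subr_eq0.
set d := _ / 2 in d0.
have nearU : \forall p' \near p, U (F p' x') /\ d < `|F p' x' - g|.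
  apply: filterI; first by apply: continuous_param; exact: open_nbhs_nbhs.
  have : (fun p' => F p' x' - g) @ p --> F p x' - g.
    by apply: cvgB; [exact: continuous_param|exact: cvg_cst].
  by move=> /cvgr_norm_gt; apply; move: d0; rewrite /d; lra.
near=> p' r; exists x' => //; have [Up' dp'] : U (F p' x') /\ d < `|F p' x' - g|.
  by near: p'.
split=> //=; rewrite in_itv/= => /andP[h1 h2].
have rd : r < d by near: r; exact: nbhs_right_lt.
by move: dp'; rewrite ltNge ler_norml; apply/negP/negPn; lra.
Unshelve. all: by end_near. Qed.

(** However thin [K] is, a Cantor set of nearly full measure meets the images of
    [K] under all curves of a compact family: its gaps are chosen after [K] and
    the family, each one small enough for all the curves at once.  Compactness
    of [K] lets this persist in the limit. *)
Lemma Cantor_set_meeting_curves (R : realType) (T : topologicalType) (P : set T)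
    (K : set R) (F : T -> R -> R) (M e : R) :
  compact P -> (forall x, continuous (F^~ x)) -> (forall p, continuous (F p)) ->
  (forall p x g (V : set R), P p -> K x -> nbhs x V ->
     exists x', [/\ K x', V x' & F p x' != g]) ->
  0 < M -> 0 < e -> compact K -> K !=set0 ->
  (forall p x, P p -> K x -> 0 < F p x < M) ->
  exists K' : set R, [/\ Cantor_set K',
    (M%:E <= lebesgue_measure K' + e%:E)%E & meets_curves P K F K'].
Proof.
move=> compactP continuous_param continuous_curve nonconstant M0 e0 cptK [x0 Kx0] FM.
have hits0 : meets_curves P K F `]0, M[%classic.
  by move=> p Pp; exists x0 => //=; rewrite in_itv/=; exact: FM.
have [K' [U [CK' mK' hU outK']]] := sparse_Cantor_set M0 e0 hits0
  (fun U g oU hU _ => meets_curves_setD_itv g compactP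
    continuous_param continuous_curve nonconstant oU hU).
exists K'; split => // p Pp; apply: contrapT => noK'.
have /compact_near_coveringP := cptK.
move=> /(_ _ \oo (fun n x => ~ U n (F p x)) _) [].
  move=> x Kx.
  have nK' : ~ K' (F p x) by move=> ?; apply: noK'; exists x.
  have [[A B] /= [nA nB] AB] := outK' _ (FM _ _ Pp Kx) nK'.
  exists (F p @^-1` A, B) => /=.
    by split => //; exact: continuous_curve.
  by move=> [x' n] /= [Ax' Bn]; exact: (AB (F p x', n)).
move=> N _ /(_ N (leqnn N)) outN.
by have [x Kx Ux] := hU N _ Pp; exact: (outN x Kx).
Qed.

(** * Circular arcs *)

(** The parameter is [p = (c, k, d)]; the graph over [x] is the upper half of the
    circle of radius [d] about the point [(k, c)]. *)
Definition upper_arc (R : realType) (p : R * R * R) (x : R) : R :=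
  p.1.1 + Num.sqrt (p.2 ^+ 2 - (x - p.1.2) ^+ 2).

Lemma upper_arc_bounds (R : realType) (c k d x : R) : `|x - k| < d ->
  c < upper_arc (c, k, d) x <= c + d.
Proof.
rewrite /upper_arc /= => xkd.
have d0 : 0 < d by apply: le_lt_trans xkd.
have : (x - k) ^+ 2 < d ^+ 2 by rewrite -real_normK ?num_real// ltrXn2r// ?nnegrE ltW.
move=> h; rewrite ltrDl sqrtr_gt0 subr_gt0 h lerD2l.
by rewrite -[leRHS](ger0_norm (ltW d0)) -sqrtr_sqr ler_wsqrtr// gerBl sqr_ge0.
Qed.

Lemma euclidean_norm_upper_arc (R : realType) (c k d x : R) : `|x - k| < d ->
  euclidean_norm ((k, c) - (x, upper_arc (c, k, d) x)) = d.
Proof.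
move=> xkd; rewrite /euclidean_norm /upper_arc /=.
have d0 : 0 < d by apply: le_lt_trans xkd.
have h : (x - k) ^+ 2 <= d ^+ 2 by rewrite -real_normK ?num_real// lerXn2r// ?nnegrE ltW.
rewrite opprD addrA subrr add0r sqrrN sqr_sqrtr ?subr_ge0//.
by rewrite -(sqrrN (k - x)) opprB addrC subrK sqrtr_sqr gtr0_norm.
Qed.

(** A height is attained over at most two abscissas, [x] and its mirror image
    [k + k - x], and [x] is a limit point of [K]. *)
Lemma upper_arc_nonconstant (R : realType) (K : set R) (p : R * R * R) (x g : R)
    (V : set R) :
  limit_point K x -> K x -> (forall y, K y -> `|y - p.1.2| < p.2) ->
  nbhs x V -> exists x', [/\ K x', V x' & upper_arc p x' != g].
Proof.
case: p => [[c k] d] /= limK Kx Kd Vx.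
have [hx|] := eqVneq (upper_arc (c, k, d) x) g; last first.
  by exists x; split => //; exact: nbhs_singleton.
(* When [x] is its own mirror image, excluding the mirror image would exclude
   [x], and the first disjunct is what keeps a neighbourhood. *)
have nW : nbhs x (V `&` ([set y | y = x] `|` [set y | y != k + k - x])).
  apply: filterI => //.
  have [xx|xx] := eqVneq x (k + k - x).
    apply: filterS filterT => y _ /=; rewrite -xx.
    by have [|] := eqVneq y x; [left|right].
  by near=> y; right; near: y; apply: open_nbhs_nbhs; split => //; exact: open_neq.
have [y [yx Ky [Vy [/= yx'|/= ykx]]]] := limK _ nW; first by rewrite yx' eqxx in yx.
exists y; split => //; rewrite -hx; apply/eqP => /addrI/eqP.
have pos z' : `|z' - k| < d -> d ^+ 2 - (z' - k) ^+ 2 \is Num.nneg.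
  move=> zk; have d0 : 0 < d by apply: le_lt_trans zk.
  by rewrite nnegrE subr_ge0 -(real_normK (num_real (z' - k))) lerXn2r// ?nnegrE ltW.
rewrite eqr_sqrt; [|exact: pos (Kd _ Ky)|exact: pos (Kd _ Kx)].
rewrite (inj_eq (addrI _)) eqr_opp eqf_sqr => /orP[/eqP/addIr/eqP|].
  by rewrite (negbTE yx).
by rewrite opprB subr_eq addrAC (negbTE ykx).
Unshelve. all: by end_near. Qed.

Lemma upper_arc_continuous_param (R : realType) (x : R) :
  continuous (@upper_arc R ^~ x).
Proof.
have cfst (A B : topologicalType) : continuous (@fst A B).
  by move=> [a b]; exact: cvg_fst.
have csnd (A B : topologicalType) : continuous (@snd A B).
  by move=> [a b]; exact: cvg_snd.
move=> p; apply: cvgD.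
  by apply: (@continuous_comp _ _ _ fst fst); exact: cfst.
apply: (@continuous_comp _ _ _ (fun p : R * R * R => p.2 ^+ 2 - (x - p.1.2) ^+ 2)
  Num.sqrt).
  apply: cvgB.
    apply: (@continuous_comp _ _ _ snd (fun y : R => y ^+ 2)).
      exact: csnd.
    exact: exprn_continuous.
  apply: (@continuous_comp _ _ _ (fun p : R * R * R => x - p.1.2)
    (fun y : R => y ^+ 2)).
    apply: cvgB; first exact: cvg_cst.
    by apply: (@continuous_comp _ _ _ fst snd); [exact: cfst|exact: csnd].
  exact: exprn_continuous.
exact: sqrt_continuous.
Qed.

Lemma upper_arc_continuous (R : realType) (p : R * R * R) :
  continuous (upper_arc p).
Proof.
move=> x; apply: cvgD; first exact: cvg_cst.
apply: (@continuous_comp _ _ _ (fun x => p.2 ^+ 2 - (x - p.1.2) ^+ 2) Num.sqrt).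
  apply: cvgB; first exact: cvg_cst.
  apply: (@continuous_comp _ _ _ (fun x => x - p.1.2) (fun y : R => y ^+ 2)).
    by apply: cvgB; [exact: cvg_id|exact: cvg_cst].
  exact: exprn_continuous.
exact: sqrt_continuous.
Qed.

(** * Chains *)

(** Each step goes to a point on the upper arc of radius [s i] about the current
    point.  Steps climb by at most [b], so the heights met before step [n] stay
    in the range [0, b * n] where the arcs are known to meet [K']; and they
    strictly climb, so that the chain never returns to a point. *)
Lemma ascending_chain (R : realType) (K K' : set R) (a b : R) (n : nat)
    (s : nat -> R) (k0 c0 : R) :
  0 <= b -> (forall i, a <= s i <= b) ->
  (forall x k, K x -> K k -> `|x - k| < a) ->
  (forall c k d, 0 <= c <= b * n%:R -> K k -> a <= d <= b ->
     exists2 x, K x & K' (upper_arc (c, k, d) x)) ->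
  K k0 -> K' c0 -> 0 <= c0 <= b ->
  exists z : nat -> R * R, [/\ z 0%N = (k0, c0),
    forall i, (i <= n)%N -> (K `*` K') (z i)
  & forall i, (i < n)%N -> (z i).2 < (z i.+1).2 /\
      euclidean_norm (z i - z i.+1) = s i].
Proof.
move=> b0 sab Kdiam arcK' Kk0 K'c0 c0b.
pose inv i (p : R * R) := (K `*` K') p /\ 0 <= p.2 <= b * i.+1%:R.
have step (ip : nat * (R * R)) : exists p', (ip.1 < n)%N -> inv ip.1 ip.2 ->
    [/\ inv ip.1.+1 p', ip.2.2 < p'.2 & euclidean_norm (ip.2 - p') = s ip.1].
  case: ip => i [k c] /=.
  have [[ltin [[/= Kk K'c] /= /andP[c_ge0 cb]]]|bad] :=
      pselect ((i < n)%N /\ inv i (k, c)).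
    have [|x Kx K'x] := arcK' c k (s i) _ Kk (sab i).
      by rewrite c_ge0 (le_trans cb)// ler_wpM2l// ler_nat.
    have /andP[as_ sb] := sab i.
    have xk : `|x - k| < s i by apply: lt_le_trans as_; exact: Kdiam.
    have /andP[lt_c le_c] := upper_arc_bounds c xk.
    exists (x, upper_arc (c, k, s i) x) => _ _; split=> //=; last first.
      exact: euclidean_norm_upper_arc.
    split=> //=; rewrite (le_trans c_ge0 (ltW lt_c))/=.
    by rewrite (le_trans le_c)// -natr1 mulrDr mulr1 lerD.
  by exists 0 => ltin invi; case: bad.
have [next nextP] := choice step.
pose z : nat -> R * R := fix z i := if i is j.+1 then next (j, z j) else (k0, c0).
have zinv i : (i <= n)%N -> inv i (z i).
  elim: i => [_|i IH ltin]; first by rewrite /inv /= mulr1.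
  by have [] := nextP (i, z i) ltin (IH (ltnW ltin)).
exists z; split => // [i /zinv[]//|i ltin].
by have [] := nextP (i, z i) ltin (zinv _ (ltnW ltin)).
Qed.

Lemma nbhs_row_box (R : realType) (n : nat) (a : R) :
  nbhs (const_mx (a + 2^-1) : 'rV[R]_n) [set t | forall i, a <= t 0 i <= a + 1].
Proof.
apply/nbhs_ballP; exists 2^-1 => /=; first by rewrite invr_gt0.
move=> t /= [_ t_near] i; have := t_near 0 i; rewrite mxE /ball /= ltr_norml.
by lra.
Qed.

Theorem theorem2p4 (R : realType) (K : set R) (n : nat) :
  Cantor_set K -> (1 <= n)%N ->
  exists K' : set R,
    [/\ Cantor_set K',
        (lebesgue_measure K < lebesgue_measure K')%E
      & exists2 y : R * R, (K `*` K') y &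
          interior (pinned_chain_distance_set (n := n) (K `*` K') y) !=set0].
Proof.
move=> [[k0 Kk0] cptK _ [_ limK]] n_gt0.
have [N N0 KN] : exists2 N : R, 0 < N & forall x, K x -> `|x| <= N.
  have [N0 [_ KN]] := compact_bounded cptK.
  exists (`|N0| + 1); first by rewrite ltr_wpDl.
  by move=> x Kx; apply: KN Kx; rewrite (le_lt_trans (ler_norm _))// ltrDl.
(* Lengths range over [a, b] with [a] larger than the diameter of [K], so that
   arcs are defined over all of [K]; [M] exceeds the height of [n + 1] steps, the
   additional one serving to find the pin, and is larger than the measure of
   [K] by more than the total length of the gaps. *)
pose a := N + N + 1; pose b := a + 1; pose M := b * n%:R + b + 1.
have b0 : 0 < b by rewrite /b /a; lra.
have Kdiam x k : K x -> K k -> `|x - k| < a.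
  move=> /KN xN /KN kN; apply: (le_lt_trans (ler_normB _ _)).
  by rewrite /a; lra.
pose P := (`[0, b * n%:R]%classic `*` K) `*` `[a, b]%classic.
have cptP : compact P.
  by apply: compact_setX; [apply: compact_setX => //|]; exact: segment_compact.
have PE c k d : P (c, k, d) <-> [/\ 0 <= c <= b * n%:R, K k & a <= d <= b].
  by rewrite /P /= !in_itv; split=> [[[]]|[]].
have bn0 : b <= b * n%:R by rewrite ler_peMr ?ler1n// ltW.
have [K' [CK' mK' K'P]] : exists K' : set R, [/\ Cantor_set K',
    (M%:E <= lebesgue_measure K' + 1%:E)%E & meets_curves P K (@upper_arc R) K'].
  apply: Cantor_set_meeting_curves => //.
  - exact: upper_arc_continuous_param.
  - exact: upper_arc_continuous.
  - move=> [[c k] d] x g V /PE[_ Kk /andP[ad _]] Kx.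
    have Kd y : K y -> `|y - k| < d by move=> Ky; apply: lt_le_trans ad; exact: Kdiam.
    by apply: upper_arc_nonconstant => //; rewrite limK.
  - rewrite /M; clearbody b; set bn := b * _ in bn0 *; lra.
  - by exists k0.
  - move=> [[c k] d] x /PE[/andP[c0 cb] Kk /andP[ad db]] Kx.
    have xk : `|x - k| < d by apply: lt_le_trans ad; exact: Kdiam.
    have := upper_arc_bounds c xk; rewrite /M.
    by set bn := b * _ in cb *; lra.
have arcK' c k d : 0 <= c <= b * n%:R -> K k -> a <= d <= b ->
    exists2 x, K x & K' (upper_arc (c, k, d) x).
  by move=> cb Kk dab; apply: K'P; apply/PE.
(* The pin is one arc above a point of height 0, so that its height is at
   most [b]. *)
have [x0 Kx0 K'x0] : exists2 x, K x & K' (upper_arc (0, k0, b) x).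
  apply: arcK' => //; first by rewrite lexx (le_trans (ltW b0) bn0).
  by rewrite lexx andbT /b; lra.
set c0 := upper_arc _ _ in K'x0.
have c0b : 0 <= c0 <= b.
  have xk : `|x0 - k0| < b by apply: (lt_trans (Kdiam _ _ Kx0 Kk0)); rewrite /b; lra.
  by have := upper_arc_bounds 0 xk; rewrite -/c0; lra.
exists K'; split => //.
- have mK : (lebesgue_measure K <= (N + N)%:E)%E.
    have -> : (N + N)%:E = lebesgue_measure (`[- N, N]%classic : set R).
      by rewrite lebesgue_measure_itv/= lte_fin gtrN// -EFinD opprK.
    apply: le_measure; rewrite ?inE;
      [exact: measurable_realfun.compact_measurable|exact: measurable_itv|].
    by move=> x /KN; rewrite /= in_itv/= -ler_norml.
  apply: (le_lt_trans mK); rewrite -(lteD2rE (x := 1%:E))//.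
  apply: lt_le_trans mK'; rewrite -EFinD lte_fin /M.
  have := lt_le_trans b0 bn0; set bn := b * _; rewrite /b /a; lra.
exists (k0, c0) => //.
exists (const_mx (a + 2^-1)); apply: filterS (nbhs_row_box n a) => t /= tab.
pose s i := if insub i is Some j then t 0 j else a.
have sab i : a <= s i <= b.
  rewrite /s; case: insubP => [j _ _|_]; first exact: tab.
  by rewrite lexx /b lerDl ler01.
have [z [z0 zK z_next]] := ascending_chain (ltW b0) sab Kdiam arcK' Kk0 K'x0 c0b.
have z_lt i j : (i < j)%N -> (j <= n)%N -> (z i).2 < (z j).2.
  elim: j => // j IH; rewrite ltnS leq_eqVlt => /predU1P[->|ij] jn.
    by have [] := z_next _ jn.
  by apply: lt_trans (IH ij (ltnW jn)) _; have [] := z_next _ jn.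
exists (fun i : 'I_n.+1 => z i); split => //.
- by move=> i; apply: zK; rewrite -ltnS.
- move=> i j /= zij; apply: ord_inj; have [ij|ij|//] := ltngtP i j.
    by have := z_lt _ _ ij (leq_ord j); rewrite zij ltxx.
  by have := z_lt _ _ ij (leq_ord i); rewrite zij ltxx.
- apply/rowP => i; rewrite mxE /=; have [_] := z_next i (ltn_ord i).
  by rewrite /bump /= add1n => ->; rewrite /s valK.
Qed.
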